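(* Let $h:\mathbb{R}^n\to(-\infty,+\infty]$ be strictly convex, with $\operatorname{int}\operatorname{dom} h\neq\emptyset$ (so $\operatorname{rint}\operatorname{dom} h$ is open), and twice continuously differentiable on $\operatorname{rint}\operatorname{dom} h$. Then the intrinsic triangle scaling exponent of the Bregman distance $D_h$ is $2$. Specifically, for any $x,z,\tilde z\in\operatorname{rint}\operatorname{dom} h$, $$\lim_{\theta\to 0^+}\frac{D_h\big((1-\theta)x+\theta z,\;(1-\theta)x+\theta\tilde z\big)}{\theta^2}=\frac12\big\langle\nabla^2h(x)(z-\tilde z),\,z-\tilde z\big\rangle .$$
   Context: Here $n\ge 1$, $\operatorname{rint}$ denotes relative interior and $\langle\cdot,\cdot\rangle$ is the standard inner product on $\mathbb{R}^n$. The Bregman distance generated by $h$ is $D_h(x,y)=h(x)-h(y)-\langle\nabla h(y),x-y\rangle$ for $x\in\operatorname{dom}h$, $y\in\operatorname{rint}\operatorname{dom}h$. The intrinsic triangle scaling exponent (intrinsic TSE) of $D_h$, denoted $\gamma_{\mathrm{in}}$, is the largest $\gamma$ such that for all $x,z,\tilde z\in\operatorname{rint}\operatorname{dom}h$, $$\limsup_{\theta\to0^+}\frac{D_h\big((1-\theta)x+\theta z,(1-\theta)x+\theta\tilde z\big)}{\theta^\gamma}<\infty .$$ *)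

(* Defs.v *)
From mathcomp Require Import all_boot all_order all_algebra.
From mathcomp Require Import all_classical all_reals all_analysis.

Set Implicit Arguments.
Unset Strict Implicit.
Unset Printing Implicit Defensive.

Import Order.TTheory GRing.Theory Num.Theory.
Import numFieldNormedType.Exports.

Local Open Scope classical_set_scope.
Local Open Scope ring_scope.

(* Points of R^n are row vectors.  The library normed-space structure on
   'rV[R]_n uses the sup norm; it is only used here through the topology and
   the notion of differentiability, which do not depend on the norm. *)

Section Euclidean.
Variables (R : realType) (n : nat).
Implicit Types (u v x y : 'rV[R]_n) (A U : set 'rV[R]_n) (f : 'rV[R]_n -> R).

Definition dotv u v : R := \sum_(i < n) u 0 i * v 0 i.

Definition gradient f x : 'rV[R]_n := \row_(i < n) 'D_(delta_mx 0 i) f x.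

Definition hessian f x : 'M[R]_n :=
  \matrix_(i < n, j < n)
    'D_(delta_mx 0 i) (fun y => 'D_(delta_mx 0 j) f y) x.

(* Meaningful when U is a neighbourhood of each of its points, since values of
   f outside U are then irrelevant. *)
Definition twice_continuously_differentiable U f : Prop :=
  forall x, U x ->
    [/\ differentiable f x,
        differentiable (gradient f) x
      & hessian f y @[y --> x] --> hessian f x].

Definition affine_hull A : set 'rV[R]_n :=
  [set y | exists (m : nat) (p : 'I_m -> 'rV[R]_n) (a : 'I_m -> R),
     [/\ forall i, A (p i), \sum_(i < m) a i = 1
       & y = \sum_(i < m) a i *: p i]].

Definition relint A : set 'rV[R]_n :=
  [set x | A x /\ \forall y \near x, affine_hull A y -> A y].

End Euclidean.

Section Bregman.
Variables (R : realType) (n : nat).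
Implicit Types (h : 'rV[R]_n -> \bar R) (x y z : 'rV[R]_n).

Definition dom h : set 'rV[R]_n := [set x | (h x < +oo)%E].

Definition strictly_convex h : Prop :=
  forall x y (t : R), dom h x -> dom h y -> x != y -> 0 < t < 1 ->
    (h ((1 - t) *: x + t *: y)%R < (1 - t)%R%:E * h x + t%:E * h y)%E.

(* The real values of h on dom h when h never takes the value -oo; the
   convention fine +oo = 0 only matters off dom h. *)
Definition fine_fun h : 'rV[R]_n -> R := fun x => fine (h x).

(* Only meaningful for x in dom h and y in relint (dom h). *)
Definition bregman h x y : R :=
  fine_fun h x - fine_fun h y - dotv (gradient (fine_fun h) y) (x - y).

Definition triangle_scaling_exponents h : set R :=
  [set gamma | forall x z z',
     relint (dom h) x -> relint (dom h) z -> relint (dom h) z' ->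
     (limf_esup
        (fun theta : R =>
           (bregman h ((1 - theta) *: x + theta *: z)
                      ((1 - theta) *: x + theta *: z')
              / theta `^ gamma)%R%:E)
        0^'+ < +oo)%E].

Definition is_intrinsic_TSE h (gamma : R) : Prop :=
  triangle_scaling_exponents h gamma /\
  ubound (triangle_scaling_exponents h) gamma.

End Bregman.

(* Main.v *)
Require Import Defs.
From mathcomp Require Import all_boot all_order all_algebra.
From mathcomp Require Import all_classical all_reals all_analysis.
From mathcomp Require Import ring lra.

Set Implicit Arguments.
Unset Strict Implicit.
Unset Printing Implicit Defensive.

Import Order.TTheory GRing.Theory Num.Theory.
Import numFieldNormedType.Exports.

Local Open Scope classical_set_scope.
Local Open Scope ring_scope.

(** Write f for h on the interior U of its domain, which is also its relative
    interior ([relint_interior]). Put y = x + s (z' - x) and v = z - z', so that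
    x + s (z - x) = y + s v and the quantity to estimate is
    f (y + s v) - f y - <grad f y, s v>. It is the second-order Taylor
    remainder of f at y along s v, and as s tends to 0 the whole segment from y
    to y + s v shrinks to x at speed s; hence it is s^2 / 2 times the Hessian
    form of f at x on v, up to o(s^2).

    The proof goes through the gradient: a mean value argument
    ([second_order_mean]) expresses the remainder, minus its expected
    value, as an increment of the gradient minus its expected value, and the
    differential of the gradient at x controls this error
    ([bregman_estimate], [bregman_cvg]).

    The limit shows that the exponent 2 is admissible. If some gamma > 2 were
    admissible, the limit would be nonpositive for all choices of x, z and z'
    ([cvg_div_exprn_le0]). But strict convexity forces the Hessian form
    to be positive somewhere: otherwise f would be concave along segments
    ([exists_positive_curvature]). Taking x such a point, z = x + v in a
    direction v of positive curvature and z' = x gives a contradiction. *)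

(** * Relative interior of a set with nonempty interior *)

Lemma cvg_line (R : realType) (n : nat) (c v : 'rV[R]_n) :
  c + s *: v @[s --> (0 : R)^'+] --> c.
Proof.
suff : c + s *: v @[s --> (0 : R)^'+] --> c + 0 *: v by rewrite scale0r addr0.
apply: cvg_at_right_filter; apply: cvgD; first exact: cvg_cst.
by apply: cvgZr_tmp; exact: cvg_id.
Qed.

(** Shrinking y towards c until it enters A exhibits y as an affine
    combination of c and a point of A. *)
Lemma affine_hull_nbhs (R : realType) (n : nat) (A : set 'rV[R]_n)
  (c y : 'rV[R]_n) : nbhs c A -> affine_hull A y.
Proof.
move=> Ac; near (0 : R)^'+ => s.
have s0 : 0 < s by near: s; exact: nbhs_right_gt.
exists 2%N, (fun i => if i == ord0 then c else c + s *: (y - c)),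
  (fun i => if i == ord0 then 1 - s^-1 else s^-1); split.
- move=> i; case: ifPn => _; first exact: nbhs_singleton.
  by near: s; have := cvg_line (y - c) Ac; apply.
- by rewrite !big_ord_recl big_ord0 /= addr0 subrK.
- rewrite !big_ord_recl big_ord0 /= addr0 scalerDr scalerA mulVf ?gt_eqF//.
  by rewrite scalerBl !scale1r addrA subrK addrC subrK.
Unshelve. all: by end_near. Qed.

Lemma relint_interior (R : realType) (n : nat) (A : set 'rV[R]_n) :
  A° !=set0 -> relint A = A°.
Proof.
move=> [c Ac]; apply/seteqP; split=> [x [_ Ax]|x Ax].
  by apply: filterS Ax => y; apply; exact: affine_hull_nbhs Ac.
by split; [exact: nbhs_singleton|apply: filterS Ax].
Qed.

(** * Gradient, Hessian and inner product *)

Lemma diff_line (R : realType) (n : nat) (W : normedModType R)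
    (F : 'rV[R]_n -> W) (b w : 'rV[R]_n) (t : R) :
  differentiable F (b + t *: w) ->
  is_derive t 1 (fun s => F (b + s *: w)) ('D_w F (b + t *: w)).
Proof.
move=> dF.
have dl : is_diff t (fun s : R => b + s *: w) (fun s => s *: w).
  by apply: is_diff_eq; rewrite add0r.
have dc := is_diff_comp dl (differentiableP dF).
have dFl : differentiable (fun s : R => F (b + s *: w)) t.
  exact: (@ex_diff _ _ _ _ _ _ _ dc).
split; first exact: diff_derivable.
by rewrite deriveE// (@diff_val _ _ _ _ _ _ _ dc) /= scale1r deriveE.
Qed.

Lemma derive_dotv_gradient (R : realType) (n : nat) (f : 'rV[R]_n -> R)
    (x v : 'rV[R]_n) :
  differentiable f x -> 'D_v f x = dotv (gradient f x) v.
Proof.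
move=> df; rewrite deriveE// {1}(row_sum_delta v) linear_sum /dotv.
by apply: eq_bigr => i _; rewrite linearZ /= mxE deriveE// mulrC.
Qed.

(** The partial derivatives of the gradient make up the rows of the Hessian,
    so directions multiply it on the left. *)
Lemma derive_gradient (R : realType) (n : nat) (f : 'rV[R]_n -> R)
    (x v : 'rV[R]_n) :
  differentiable (gradient f) x -> 'D_v (gradient f) x = v *m hessian f x.
Proof.
move=> dG; rewrite deriveE// {1}(row_sum_delta v) linear_sum.
rewrite mulmx_sum_row; apply: eq_bigr => i _; rewrite linearZ /=.
rewrite -deriveE// derive_mx; last exact: diff_derivable.
congr (_ *: _); apply/rowP => j; rewrite !mxE.
by congr ('D_ _ _ _); apply/funext => y; rewrite mxE.
Qed.

(** A quadratic form depends only on the symmetric part of its matrix. This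
    reconciles [derive_gradient] with the transposed Hessian of the theorem. *)
Lemma dotv_mul_tr (R : realType) (n : nat) (H : 'M[R]_n) (v : 'rV[R]_n) :
  dotv (v *m H^T) v = dotv (v *m H) v.
Proof.
rewrite /dotv.
under eq_bigr do rewrite mxE big_distrl.
under [RHS]eq_bigr do rewrite mxE big_distrl.
rewrite exchange_big; apply: eq_bigr => i _; apply: eq_bigr => j _.
by rewrite mxE /=; ring.
Qed.

Lemma dotvBl (R : realType) (n : nat) (u v w : 'rV[R]_n) :
  dotv (u - v) w = dotv u w - dotv v w.
Proof. by rewrite -sumrB; apply: eq_bigr => i _; rewrite !mxE mulrBl. Qed.

Lemma dotvDl (R : realType) (n : nat) (u v w : 'rV[R]_n) :
  dotv (u + v) w = dotv u w + dotv v w.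
Proof. by rewrite -big_split; apply: eq_bigr => i _; rewrite !mxE mulrDl. Qed.

Lemma dotvZl (R : realType) (n : nat) (a : R) (u v : 'rV[R]_n) :
  dotv (a *: u) v = a * dotv u v.
Proof. by rewrite mulr_sumr; apply: eq_bigr => i _; rewrite !mxE mulrA. Qed.

Lemma dotvZr (R : realType) (n : nat) (a : R) (u v : 'rV[R]_n) :
  dotv u (a *: v) = a * dotv u v.
Proof. by rewrite mulr_sumr; apply: eq_bigr => i _; rewrite !mxE mulrCA. Qed.

(** Hoelder's inequality: the norm of 'rV[R]_n is the sup norm, so its dual
    is the l^1 norm. *)
Lemma dotv_le (R : realType) (n : nat) (u v : 'rV[R]_n) :
  `|dotv u v| <= `|u| * \sum_(i < n) `|v 0 i|.
Proof.
apply: le_trans (ler_norm_sum _ _ _) _.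
rewrite mulr_sumr; apply: ler_sum => i _; rewrite normrM ler_wpM2r//.
rewrite [leRHS]/Num.Def.normr /= mx_normrE.
exact: (le_bigmax _ (fun i => `|u i.1 i.2|) (0, i)).
Qed.

(** * Second-order behaviour of the Bregman distance *)

Lemma MVT_derive (R : realType) (g dg : R -> R) (a b : R) : a < b ->
  (forall t, a <= t <= b -> is_derive t 1 g (dg t)) ->
  exists2 c, a < c < b & g b - g a = dg c * (b - a).
Proof.
move=> ab dgP; have [| |c] := @MVT R g dg a b ab.
- by move=> t; rewrite in_itv /= => /andP[? ?]; apply: dgP; rewrite !ltW.
- apply: derivable_within_continuous => t; rewrite in_itv /= => /dgP dt.
  exact: ex_derive.
- by rewrite in_itv /=; exists c.
Qed.

(** Mean value theorem on [0, 1] for the remainder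
    f (b + t *: w) - t * dotv (gradient f b) w - c / 2 * t ^+ 2, where c stands
    for the expected second derivative. Subtracting the parabola beforehand
    turns a second-order statement on f into a comparison between an increment
    of its gradient and the linear function t * c, which a first-order
    expansion of the gradient can settle. *)
Lemma second_order_mean (R : realType) (n : nat) (f : 'rV[R]_n -> R)
    (b w : 'rV[R]_n) (c : R) :
  (forall t, 0 <= t <= 1 -> differentiable f (b + t *: w)) ->
  exists2 t, 0 < t < 1 &
    f (b + w) - f b - dotv (gradient f b) w - c / 2 =
    dotv (gradient f (b + t *: w) - gradient f b) w - t * c.
Proof.
move=> df.
pose g (t : R) := f (b + t *: w) - (dotv (gradient f b) w * t + c / 2 * t ^+ 2).
pose dg (t : R) :=
  dotv (gradient f (b + t *: w)) w - (dotv (gradient f b) w + c * t).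
have [|t t01 gE] := @MVT_derive R g dg 0 1 ltr01.
  move=> t /df dft; rewrite /g /dg.
  have dl := diff_line dft; rewrite derive_dotv_gradient// in dl.
  apply: is_deriveB.
  by apply: is_derive_eq; rewrite /GRing.scale /=; field.
exists t => //; move: gE; rewrite /g /dg dotvBl scale1r scale0r addr0.
lra.
Qed.

Lemma diff_gradient_le (R : realType) (n : nat) (f : 'rV[R]_n -> R)
    (x : 'rV[R]_n) (e : R) : 0 < e -> differentiable (gradient f) x ->
  \forall u \near (0 : 'rV[R]_n),
    `|gradient f (x + u) - gradient f x - u *m hessian f x| <= e * `|u|.
Proof.
move=> e0 dG; have /eqaddoP/(_ _ e0) := diff_locally dG.
apply: filterS => u /=.
rewrite -derive_gradient// deriveE// (addrC x) -addrA -opprD.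
by apply.
Qed.

(** In [second_order_mean] with w = s *: v and c = s ^+ 2 times the Hessian
    form of v, both gradients on the right-hand side are taken within O(s) of
    x; replacing them by their first-order expansions at x cancels the
    quadratic term and leaves s times an error in o(s). *)
Lemma bregman_estimate (R : realType) (n : nat) (h : 'rV[R]_n -> \bar R)
    (x p v : 'rV[R]_n) (e : R) :
  0 < e ->
  (\forall y \near x, differentiable (fine_fun h) y) ->
  differentiable (gradient (fine_fun h)) x ->
  \forall s \near (0 : R)^'+,
    `|bregman h (x + s *: p + s *: v) (x + s *: p) -
      s ^+ 2 * (2^-1 * dotv (v *m hessian (fine_fun h) x) v)|
    <= s ^+ 2 * e.
Proof.
set f := fine_fun h; set H := hessian f x => e0 df dG.
(* K bounds the sum of the distances from x, divided by s, of the two points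
   where the gradient is evaluated; S is the dual norm of v. *)
pose K := 2 * `|p| + `|v|; pose S := \sum_(i < n) `|v 0 i|.
have K0 : 0 <= K by rewrite addr_ge0 ?mulr_ge0.
have S0 : 0 <= S by apply: sumr_ge0.
have [e1 e10 e1KS] : exists2 e1 : R, 0 < e1 & e1 * (K * S) <= e.
  have KS1 : 0 < K * S + 1 by rewrite ltr_wpDl// mulr_ge0.
  exists (e / (K * S + 1)); first by rewrite divr_gt0.
  by rewrite -mulrA ler_piMr ?(ltW e0)// ler_pdivrMl// mulr1 lerDl.
have [r /= r0 dfG] : exists2 r : R, 0 < r & forall u : 'rV[R]_n, `|u| < r ->
    differentiable f (x + u) /\
    `|gradient f (x + u) - gradient f x - u *m H| <= e1 * `|u|.
  have [r /= r0 dfr] := (nbhs_normP _ _).1 df.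
  have [r' /= r'0 dGr] :=
    (nbhs_normP (0 : 'rV[R]_n) _).1 (diff_gradient_le e10 dG).
  exists (Num.min r r'); first by rewrite lt_min r0.
  move=> u; rewrite lt_min => /andP[ur ur']; split.
    by apply: dfr; rewrite /= opprD addrA subrr add0r normrN.
  by apply: dGr; rewrite /= sub0r normrN.
near=> s.
have s0 : 0 < s by near: s; exact: nbhs_right_gt.
have sK : s * (K + 1) < r.
  rewrite -ltr_pdivlMr ?ltr_wpDl//.
  by near: s; apply: nbhs_right_lt; rewrite divr_gt0 ?ltr_wpDl.
have uK t : 0 <= t <= 1 -> `|s *: (p + t *: v)| <= s * (`|p| + `|v|).
  move=> /andP[t0 t1]; rewrite normrZ gtr0_norm// ler_pM2l//.
  rewrite (le_trans (ler_normD _ _))// lerD2l normrZ ger0_norm//.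
  by rewrite ler_piMl.
have lineE t : x + s *: p + t *: (s *: v) = x + s *: (p + t *: v).
  by rewrite scalerDr !scalerA (mulrC t) addrA.
have ur t : 0 <= t <= 1 -> `|s *: (p + t *: v)| < r.
  move=> /uK /le_lt_trans; apply; apply: le_lt_trans sK.
  rewrite ler_pM2l// /K.
  have := normr_ge0 p; lra.
have [|t /andP[t0 t1] tE] := @second_order_mean R n f (x + s *: p) (s *: v)
    (s ^+ 2 * dotv (v *m H) v).
  by move=> t /ur /dfG[]; rewrite lineE.
have -> : bregman h (x + s *: p + s *: v) (x + s *: p) -
    s ^+ 2 * (2^-1 * dotv (v *m H) v) =
    s * dotv ((gradient f (x + s *: (p + t *: v)) - gradient f x -
                (s *: (p + t *: v)) *m H) -
              (gradient f (x + s *: p) - gradient f x - (s *: p) *m H)) v.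
  rewrite /bregman -/f (addrC _ (s *: v)) addrK [_ + (x + _)]addrC.
  rewrite [X in _ - X](_ : _ = s ^+ 2 * dotv (v *m H) v / 2); last by field.
  rewrite tE lineE dotvZr -!scalemxAl mulmxDl -scalemxAl.
  rewrite !(dotvBl, dotvZl) dotvDl dotvZl; ring.
rewrite normrM gtr0_norm// expr2 -mulrA ler_pM2l//.
apply: le_trans (dotv_le _ _) _; rewrite -/S.
have [|_ Gp] := dfG (s *: p).
  by have := ur 0; rewrite scale0r addr0 lexx ler01; apply.
have [|_ Gq] := dfG (s *: (p + t *: v)); first by apply: ur; rewrite !ltW.
apply: (@le_trans _ _ (s * (e1 * (K * S)))); last by rewrite ler_pM2l.
rewrite !mulrA ler_wpM2r// (le_trans (ler_normB _ _))//.
apply: (le_trans (lerD Gq Gp)); rewrite -mulrDr [s * e1]mulrC -(mulrA e1 s K).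
rewrite ler_pM2l//.
rewrite [`|s *: p|]normrZ gtr0_norm//.
have := uK t; rewrite (ltW t0) (ltW t1) => /(_ isT).
rewrite /K; lra.
Unshelve. all: by end_near. Qed.

Lemma bregman_cvg (R : realType) (n : nat) (h : 'rV[R]_n -> \bar R)
    (x z z' : 'rV[R]_n) :
  (\forall y \near x, differentiable (fine_fun h) y) ->
  differentiable (gradient (fine_fun h)) x ->
  bregman h ((1 - s) *: x + s *: z) ((1 - s) *: x + s *: z') / s ^+ 2
    @[s --> (0 : R)^'+] -->
  2^-1 * dotv ((z - z') *m (hessian (fine_fun h) x)^T) (z - z').
Proof.
move=> df dG; rewrite dotv_mul_tr; apply/cvgrPdist_le => e e0.
have lineE (s : R) y : (1 - s) *: x + s *: y = x + s *: (y - x).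
  by rewrite scalerBl scale1r scalerBr addrA addrAC.
have := bregman_estimate (z' - x) (z - z') e0 df dG.
apply: filter_app; near=> s.
have s2 : 0 < s ^+ 2 by rewrite exprn_gt0//; near: s; exact: nbhs_right_gt.
have zE : x + s *: (z - x) = x + s *: (z' - x) + s *: (z - z').
  by rewrite -addrA -scalerDr [z' - x + _]addrC addrA subrK.
rewrite !lineE zE.
move=> He; rewrite distrC -(ler_pM2l s2) -{1}(gtr0_norm s2) -normrM.
by rewrite mulrBr mulrCA divff ?gt_eqF// mulr1.
Unshelve. all: by end_near. Qed.

(** * Superior limits and powers *)

Lemma limf_esup_ltyP (T : choiceType) (X : filteredType T) (R : realType)
    (F : set_system X) (FF : Filter F) (f : X -> R) :
  (limf_esup (fun t => (f t)%:E) F < +oo)%E <->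
  exists M, \forall t \near F, f t <= M.
Proof.
rewrite limf_esupE; split=> [/ereal_inf_lt[_ [V FV <-]] supV|[M fM]].
  have [M supM] : exists M : R, (ereal_sup [set (f t)%:E | t in V] <= M%:E)%E.
    case: (ereal_sup _) supV => [r _| |_]; [by exists r|by rewrite ltxx|].
    by exists 0; rewrite leNye.
  exists M; apply: filterS FV => t Vt; rewrite -lee_fin.
  by apply: le_trans supM; apply: ereal_sup_ubound; exists t.
apply: (@le_lt_trans _ _ M%:E); last exact: ltry.
apply: (@le_trans _ _ (ereal_sup [set (f t)%:E | t in [set t | f t <= M]])).
  by apply: ereal_inf_lbound; exists [set t | f t <= M].
by apply: ge_ereal_sup => _ [t ft <-]; rewrite lee_fin.
Qed.

(** Where f s / s `^ gamma is at most M, f s / s ^+ m is at most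
    M * s `^ (gamma - m), which tends to 0. *)
Lemma cvg_div_exprn_le0 (R : realType) (f : R -> R) (m : nat) (gamma M l : R) :
  m%:R < gamma ->
  f s / s ^+ m @[s --> (0 : R)^'+] --> l ->
  (\forall s \near (0 : R)^'+, f s / s `^ gamma <= M) -> l <= 0.
Proof.
rewrite -subr_gt0 => mgamma fl fM; rewrite -(mulr0 M).
have gM : M * s `^ (gamma - m%:R) @[s --> (0 : R)^'+] --> M * 0.
  exact: cvgMl_tmp (powR_cvg0 mgamma).
apply: ler_cvg_to fl gM _.
near=> s.
have s0 : 0 < s by near: s; exact: nbhs_right_gt.
have -> : f s / s ^+ m = f s / s `^ gamma * s `^ (gamma - m%:R).
  rewrite -mulrA -powRN -powRD; last by rewrite (gt_eqF s0) implybT.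
  by rewrite addKr powRN powR_mulrn// ltW.
by rewrite ler_pM2r ?powR_gt0//; near: s.
Unshelve. all: by end_near. Qed.

(** * Positive curvature from strict convexity *)

Lemma is_derive_dotv (R : realType) (n : nat) (G : R -> 'rV[R]_n)
    (v dG : 'rV[R]_n) (t : R) :
  is_derive t 1 G dG -> is_derive t 1 (fun s => dotv (G s) v) (dotv dG v).
Proof.
move=> dGP; rewrite /dotv.
rewrite (_ : (fun s => _) =
    \sum_(i < n) (fun s => G s 0 i * v 0 i)); last first.
  by apply/funext => s; rewrite fct_sumE.
apply: is_derive_sum => i.
have dGi : is_derive t 1 (fun s => G s 0 i) (dG 0 i).
  have /derivable_mxP dGij := @ex_derive _ _ _ _ _ _ _ dGP.
  split; first exact: dGij.
  by rewrite -(@derive_val _ _ _ _ _ _ _ dGP) derive_mx ?mxE//.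
by apply: is_derive_eq; rewrite scaler0 add0r /GRing.scale /= mulrC.
Qed.

(** If t |-> h (x0 + t *: v) is strictly convex on [0, 1], its slope over
    [2^-1, 1] exceeds its slope over [0, 2^-1]. Two uses of the mean value
    theorem turn these slopes into values of the first derivative, and a third
    one turns their difference into a positive value of the second. *)
Lemma exists_positive_curvature (R : realType) (n : nat)
    (h : 'rV[R]_n -> \bar R) (U : set 'rV[R]_n) :
  (0 < n)%N -> (forall x, (-oo < h x)%E) -> strictly_convex h ->
  open U -> U !=set0 -> U `<=` dom h ->
  (forall x, U x -> differentiable (fine_fun h) x /\
                    differentiable (gradient (fine_fun h)) x) ->
  exists x z, [/\ U x, U z &
    0 < dotv ((z - x) *m (hessian (fine_fun h) x)^T) (z - x)].
Proof.
move=> n_gt0 h_gtNy h_convex Uo [x0 Ux0] Udom dU.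
(* Twice the length needed for the mean values leaves room to step by v from
   any point of the unit segment without leaving U. *)
have [v v0 Uv] : exists2 v : 'rV[R]_n, v != 0 &
    forall t : R, 0 <= t <= 2 -> U (x0 + t *: v).
  have [r /= r0 Ur] := (nbhs_normP _ _).1 (open_nbhs_nbhs (conj Uo Ux0)).
  have c1 : (const_mx 1 : 'rV[R]_n) != 0.
    apply/eqP => /rowP/(_ (Ordinal n_gt0)); rewrite !mxE.
    by move/eqP; rewrite oner_eq0.
  have N0 : 0 < `|const_mx 1 : 'rV[R]_n| by rewrite normr_gt0.
  exists ((r / 3 / `|const_mx 1 : 'rV[R]_n|) *: const_mx 1).
    by rewrite scaler_eq0 negb_or c1 andbT gt_eqF// !divr_gt0.
  move=> t /andP[t0 t2]; apply: Ur; rewrite /= opprD addrA subrr add0r normrN.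
  rewrite 2!normrZ ger0_norm// gtr0_norm ?divr_gt0// divfK ?gt_eqF//.
  have : t * r <= 2 * r by rewrite ler_pM2r.
  lra.
pose f := fine_fun h.
pose g t := f (x0 + t *: v).
pose g1 t := dotv (gradient f (x0 + t *: v)) v.
pose g2 t := dotv (v *m hessian f (x0 + t *: v)) v.
have gP (t : R) : 0 <= t <= 2 -> is_derive t 1 g (g1 t).
  move=> /Uv/dU[df _]; rewrite /g1 -derive_dotv_gradient//.
  exact: diff_line.
have g1P (t : R) : 0 <= t <= 2 -> is_derive t 1 g1 (g2 t).
  move=> /Uv/dU[_ dG].
  rewrite (_ : g2 t = dotv ('D_v (gradient f) (x0 + t *: v)) v).
    exact: is_derive_dotv (diff_line dG).
  by rewrite derive_gradient.
have hE (t : R) : 0 <= t <= 2 -> h (x0 + t *: v) = (g t)%:E.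
  move=> /Uv/Udom; rewrite /g /f /fine_fun /dom /=.
  by have := h_gtNy (x0 + t *: v); case: (h _).
have hv (t : R) : 0 <= t <= 2 -> dom h (x0 + t *: v) by move=> /Uv/Udom.
have gconv : 2 * g 2^-1 < g 0 + g 1.
  have mid : (1 - 2^-1) *: (x0 + 0 *: v) + 2^-1 *: (x0 + 1 *: v) =
      x0 + 2^-1 *: v.
    by rewrite scale0r scale1r addr0 scalerDr addrA -scalerDl subrK scale1r.
  have neq : x0 + 0 *: v != x0 + 1 *: v.
    by rewrite (inj_eq (addrI _)) scale0r scale1r eq_sym.
  have := @h_convex (x0 + 0 *: v) (x0 + 1 *: v) 2^-1.
  rewrite mid !hE; [|lra..].
  rewrite -!EFinM -EFinD lte_fin => convg.
  have := convg (hv _ _) (hv _ _) neq _; lra.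
have [||a a01 ga] := @MVT_derive R g g1 0 2^-1; first by lra.
  by move=> t ?; apply: gP; lra.
have [||b b01 gb] := @MVT_derive R g g1 2^-1 1; first by lra.
  by move=> t ?; apply: gP; lra.
have [||c cab gc] := @MVT_derive R g1 g2 a b; first by lra.
  by move=> t ?; apply: g1P; lra.
exists (x0 + c *: v), (x0 + (c + 1) *: v).
split; [apply: Uv; lra|apply: Uv; lra|].
rewrite [x0 + (c + 1) *: v]addrC addrKA -scalerBl addrAC subrr add0r scale1r.
rewrite dotv_mul_tr -/(g2 c).
have : 0 < g2 c * (b - a) by rewrite -gc; lra.
by rewrite pmulr_lgt0//; lra.
Qed.

(** * The intrinsic triangle scaling exponent *)

Theorem proposition1 (R : realType) (n : nat) (n_gt0 : (0 < n)%N)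
    (h : 'rV[R]_n -> \bar R)
    (h_gtNy : forall x : 'rV[R]_n, (-oo < h x)%E)
    (h_convex : strictly_convex h)
    (int_dom : interior (dom h) !=set0)
    (h_C2 : twice_continuously_differentiable (relint (dom h)) (fine_fun h)) :
  is_intrinsic_TSE h 2 /\
  forall x z z' : 'rV[R]_n,
    relint (dom h) x -> relint (dom h) z -> relint (dom h) z' ->
    (bregman h ((1 - theta) *: x + theta *: z)
               ((1 - theta) *: x + theta *: z') / theta ^+ 2)
      @[theta --> (0 : R)^'+]
    --> 2^-1 * dotv ((z - z') *m (hessian (fine_fun h) x)^T) (z - z').
Proof.
move: h_C2; rewrite /is_intrinsic_TSE /triangle_scaling_exponents.
rewrite relint_interior// => h_C2.
have dh y : (dom h)° y -> differentiable (fine_fun h) y /\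
    differentiable (gradient (fine_fun h)) y by move=> /h_C2[].
have cvg_h x z z' : (dom h)° x ->
    (bregman h ((1 - theta) *: x + theta *: z)
               ((1 - theta) *: x + theta *: z') / theta ^+ 2)
      @[theta --> (0 : R)^'+]
    --> 2^-1 * dotv ((z - z') *m (hessian (fine_fun h) x)^T) (z - z').
  move=> Ux; apply: bregman_cvg; last exact: (dh _ Ux).2.
  have := open_nbhs_nbhs (conj (@open_interior _ (dom h)) Ux).
  by apply: filterS => y /dh[].
split; last by move=> x z z' Ux _ _; exact: cvg_h.
split=> [x z z' Ux _ _|gamma gammaP].
  apply/limf_esup_ltyP.
  exists (2^-1 * dotv ((z - z') *m (hessian (fine_fun h) x)^T) (z - z') + 1).
  near=> s.
  have s0 : 0 <= s by near: s; exact: nbhs_right_ge.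
  rewrite powR_mulrn//; near: s; apply: cvgr_le (cvg_h x z z' Ux) _ _.
  by rewrite ltrDl.
rewrite leNgt; apply/negP => gamma2.
have [x [z [Ux Uz q0]]] := exists_positive_curvature n_gt0 h_gtNy h_convex
  (@open_interior _ _) int_dom (@interior_subset _ _) dh.
have /limf_esup_ltyP[M DM] := gammaP x z x Ux Uz Ux.
have := cvg_div_exprn_le0 gamma2 (cvg_h x z x Ux) DM.
by rewrite leNgt mulr_gt0.
Unshelve. all: by end_near. Qed.
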